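(* Let $(W,S)$ be a Coxeter system and let $\mathscr I$ be a $W$-graph ideal with respect to $J\subseteq S$, with associated $\mathcal H$-module $\mathscr S$, basis $(b_w\mid w\in\mathscr I)$ and semilinear involution $\alpha\mapsto\overline\alpha$. Let $(c_w\mid w\in\mathscr I)$ be the unique $\mathcal A$-basis of $\mathscr S$ such that for all $w\in\mathscr I$ we have $\overline{c_w}=c_w$ and $b_w=c_w+q\sum_{y\in\mathscr I,\,y<w}q_{y,w}c_y$ for certain $q_{y,w}\in\mathcal A^+$, and let $\mu_{y,w}$ be the constant term of $q_{y,w}$. Let $s\in S$ and $w\in\mathscr I$. Then $$T_sc_w=\begin{cases}-q^{-1}c_w&\text{if }s\in\mathrm D_J(w),\\ qc_w+\sum_{y\in\mathcal R(s,w)}\mu_{y,w}c_y&\text{if }s\in\mathrm{WA}_J(w),\\ qc_w+c_{sw}+\sum_{y\in\mathcal R(s,w)}\mu_{y,w}c_y&\text{if }s\in\mathrm{SA}(w),\end{cases}$$ where $\mathcal R(s,w)$ is the set of all $y\in\mathscr I$ such that $y<w$ and $s\in\mathrm D_J(y)$.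
   Context: Let $(W,S)$ be a Coxeter system with length function $l$. The Bruhat order $\le$ on $W$ is the transitive closure of the relation $u\to w$ that holds if $l(u)\le l(w)$ and $w=tu$ with $t=1$ or $t$ a conjugate of an element of $S$; the symbols $<,\le$ always refer to it. The left weak order is: $u\le_L w$ if and only if $l(wu^{-1})=l(w)-l(u)$; then $u$ is called a suffix of $w$. $\mathcal A=\mathbb Z[q,q^{-1}]$ and $\mathcal A^+=\mathbb Z[q]$. The Hecke algebra $\mathcal H=\mathcal H(W)$ is the associative $\mathcal A$-algebra generated by $\{T_s\mid s\in S\}$ subject to $T_s^2=1+(q-q^{-1})T_s$ and $T_sT_{s'}T_s\cdots=T_{s'}T_sT_{s'}\cdots$ ($m(s,s')$ factors on each side, $m(s,s')$ the order of $ss'$). The involution $a\mapsto\overline a$ of $\mathcal A$ with $\overline q=q^{-1}$ extends to an involution of $\mathcal H$ with $\overline{T_s}=T_s^{-1}=T_s-(q-q^{-1})$. For $J\subseteq S$ let $D_J=\{w\in W\mid l(ws)>l(w)\text{ for all }s\in J\}$. Let $\mathscr I$ be an ideal of $(W,\le_L)$ (every suffix of an element of $\mathscr I$ lies in $\mathscr I$) and let $J\subseteq S$ satisfy $\mathscr I\subseteq D_J$. For $w\in\mathscr I$ put $\mathrm{SA}(w)=\{s\in S\mid sw>w,\ sw\in\mathscr I\}$, $\mathrm{SD}(w)=\{s\in S\mid sw<w\}$, $\mathrm{WA}_J(w)=\{s\in S\mid sw>w,\ sw\in D_J\setminus\mathscr I\}$, $\mathrm{WD}_J(w)=\{s\in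 S\mid sw>w,\ sw\notin D_J\}$, and $\mathrm D_J(w)=\mathrm{SD}(w)\cup\mathrm{WD}_J(w)$. $\mathscr I$ is a $W$-graph ideal with respect to $J$ if: (i) there is an $\mathcal A$-free $\mathcal H$-module $\mathscr S=\mathscr S(\mathscr I,J)$ with an $\mathcal A$-basis $(b_w\mid w\in\mathscr I)$ such that $T_sb_w=b_{sw}$ if $s\in\mathrm{SA}(w)$; $T_sb_w=b_{sw}+(q-q^{-1})b_w$ if $s\in\mathrm{SD}(w)$; $T_sb_w=-q^{-1}b_w$ if $s\in\mathrm{WD}_J(w)$; and $T_sb_w=qb_w-\sum_{y\in\mathscr I,\,y<sw}r^s_{y,w}b_y$ if $s\in\mathrm{WA}_J(w)$, for some polynomials $r^s_{y,w}\in q\mathcal A^+$; (ii) $\mathscr S$ admits an $\mathcal A$-semilinear involution $\alpha\mapsto\overline\alpha$ with $\overline{b_1}=b_1$ and $\overline{h\alpha}=\overline h\,\overline\alpha$ for all $h\in\mathcal H$, $\alpha\in\mathscr S$. (In particular $1\in\mathscr I$.) It is a fact that the basis $(c_w)$ in the claim exists and is unique. *)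

(* Defs.v *)
From HB Require Import structures.
From mathcomp Require Import all_boot all_order all_algebra.
From mathcomp Require Import generic_quotient.
From mathcomp Require Import boolp classical_sets fsbigop.
From Stdlib Require Import Relation_Operators.

Set Implicit Arguments.
Unset Strict Implicit.
Unset Printing Implicit Defensive.

Import GRing.Theory.
Local Open Scope ring_scope.

(* Z[q, q^-1] is the subring { p / q^n } of Frac Z[q]. *)

Local Notation tofrac := (@FracField.tofrac {poly int}).

Definition laurent_pred : {pred {fraction {poly int}}} :=
  fun x => `[< exists (p : {poly int}) (n : nat),
                 x = tofrac p / tofrac 'X ^+ n >].

Lemma laurent_predP x :
  reflect (exists (p : {poly int}) (n : nat), x = tofrac p / tofrac 'X ^+ n)
          (x \in laurent_pred).
Proof. exact: asboolP. Qed.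

Lemma tofracX_neq0 n : tofrac 'X ^+ n != 0.
Proof. by rewrite expf_neq0 // tofrac_eq0 polyX_eq0. Qed.

Lemma laurent_subring : subring_closed laurent_pred.
Proof.
split=> [|x y|x y].
- by apply/laurent_predP; exists 1, 0%N; rewrite rmorph1 expr0 divr1.
- move=> /laurent_predP[p [n ->]] /laurent_predP[r [m ->]].
  apply/laurent_predP; exists (p * 'X ^+ m - r * 'X ^+ n), (n + m)%N.
  rewrite -mulNr addf_div ?tofracX_neq0 // exprD mulNr.
  by rewrite rmorphB !rmorphM !rmorphXn.
- move=> /laurent_predP[p [n ->]] /laurent_predP[r [m ->]].
  apply/laurent_predP; exists (p * r), (n + m)%N.
  by rewrite rmorphM exprD mulf_div.
Qed.
HB.instance Definition _ :=
  GRing.isSubringClosed.Build {fraction {poly int}} laurent_pred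
    laurent_subring.

Record laurent := Laurent {
  laurent_val : {fraction {poly int}};
  _ : laurent_val \in laurent_pred }.
HB.instance Definition _ := [isSub for laurent_val].
HB.instance Definition _ := [Choice of laurent by <:].
HB.instance Definition _ :=
  [SubChoice_isSubComNzRing of laurent by <:].

Fact of_poly_subproof (p : {poly int}) : tofrac p \in laurent_pred.
Proof. by apply/laurent_predP; exists p, 0%N; rewrite expr0 divr1. Qed.

(* The inclusion of Z[q] in Z[q, q^-1]; the variable 'X is q. *)
Definition of_poly (p : {poly int}) : laurent := Laurent (of_poly_subproof p).

Fact of_poly_zmod : zmod_morphism of_poly.
Proof. by move=> p r; apply: val_inj; rewrite /= !rmorphB. Qed.
Fact of_poly_monoid : monoid_morphism of_poly.
Proof.
by split=> [|p r]; apply: val_inj; rewrite /= ?rmorph1 // !rmorphM.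
Qed.
HB.instance Definition _ :=
  GRing.isZmodMorphism.Build {poly int} laurent of_poly of_poly_zmod.
HB.instance Definition _ :=
  GRing.isMonoidMorphism.Build {poly int} laurent of_poly of_poly_monoid.

Lemma of_poly_inj : injective of_poly.
Proof. by move=> p r /(congr1 val)/= /eqP; rewrite tofrac_eq => /eqP. Qed.

Definition lq : laurent := of_poly 'X.

Fact lqV_subproof : (tofrac 'X)^-1 \in laurent_pred.
Proof.
by apply/laurent_predP; exists 1, 1%N; rewrite rmorph1 expr1 div1r.
Qed.
Definition lqV : laurent := Laurent lqV_subproof.

Lemma lqK : lq * lqV = 1.
Proof. by apply: val_inj; rewrite /= divff // -(expr1 (tofrac 'X)) tofracX_neq0. Qed.

Lemma lqVK : lqV * lq = 1. Proof. by rewrite mulrC lqK. Qed.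

Lemma laurentP (x : laurent) :
  exists pn : {poly int} * nat, x = of_poly pn.1 * lqV ^+ pn.2.
Proof.
have /laurent_predP[p [n xE]] := valP x.
by exists (p, n); apply: val_inj; rewrite rmorphM rmorphXn /= exprVn -xE.
Qed.

(* The involution q |-> q^-1: p(q) q^-n |-> p(q^-1) q^n. *)
Definition eval_lqV (p : {poly int}) : laurent :=
  (map_poly (intmul 1) p).[lqV].

Definition lbar (x : laurent) : laurent :=
  let pn := sval (cid (laurentP x)) in eval_lqV pn.1 * lq ^+ pn.2.

Fact eval_lqV_zmod : zmod_morphism eval_lqV.
Proof. by move=> p r; rewrite /eval_lqV rmorphB hornerD hornerN. Qed.
Fact eval_lqV_monoid : monoid_morphism eval_lqV.
Proof.
by split=> [|p r]; rewrite /eval_lqV ?rmorph1 ?hornerC // rmorphM hornerM.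
Qed.
HB.instance Definition _ :=
  GRing.isZmodMorphism.Build {poly int} laurent eval_lqV eval_lqV_zmod.
HB.instance Definition _ :=
  GRing.isMonoidMorphism.Build {poly int} laurent eval_lqV eval_lqV_monoid.

Lemma eval_lqVX : eval_lqV 'X = lqV.
Proof. by rewrite /eval_lqV map_polyX hornerX. Qed.

Lemma lqXK n : lq ^+ n * lqV ^+ n = 1.
Proof. by rewrite -exprMn lqK expr1n. Qed.

Lemma lbarE p n : lbar (of_poly p * lqV ^+ n) = eval_lqV p * lq ^+ n.
Proof.
rewrite /lbar; case: cid => -[r m] /= e.
have : p * 'X ^+ m = r * 'X ^+ n.
  apply: of_poly_inj; rewrite !rmorphM !rmorphXn /= -/lq.
  have -> : of_poly p = of_poly r * lqV ^+ m * lq ^+ n.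
    by rewrite -e -mulrA [X in _ * X]mulrC lqXK mulr1.
  by rewrite mulrAC -[_ * _ * lq ^+ m]mulrA [_ ^+ m * _]mulrC lqXK mulr1.
move=> /(congr1 eval_lqV); rewrite !rmorphM !rmorphXn /= eval_lqVX => e'.
have -> : eval_lqV r = eval_lqV p * lqV ^+ m * lq ^+ n.
  by rewrite e' -mulrA [X in _ * X]mulrC lqXK mulr1.
by rewrite mulrAC -[_ * _ * lq ^+ m]mulrA [_ ^+ m * _]mulrC lqXK mulr1.
Qed.

Fact lbar_zmod : zmod_morphism lbar.
Proof.
move=> x y; have [[p n] /= ->] := laurentP x; have [[r m] /= ->] := laurentP y.
have -> : of_poly p * lqV ^+ n - of_poly r * lqV ^+ m =
  of_poly (p * 'X ^+ m - r * 'X ^+ n) * lqV ^+ (n + m).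
  rewrite rmorphB !rmorphM !rmorphXn /= -/lq mulrBl exprD; congr (_ - _).
    by rewrite mulrACA lqXK mulr1.
  by rewrite [_ ^+ n * _ ^+ m]mulrC mulrACA lqXK mulr1.
rewrite !lbarE rmorphB !rmorphM !rmorphXn /= eval_lqVX mulrBl exprD.
congr (_ - _).
  by rewrite mulrACA [lqV ^+ m * _]mulrC lqXK mulr1.
by rewrite [lq ^+ n * _ ^+ m]mulrC mulrACA [lqV ^+ n * _]mulrC lqXK mulr1.
Qed.
Fact lbar_monoid : monoid_morphism lbar.
Proof.
split=> [|x y].
  have -> : 1 = of_poly 1 * lqV ^+ 0 by rewrite rmorph1 mulr1.
  by rewrite lbarE !rmorph1 mulr1.
have [[p n] /= ->] := laurentP x; have [[r m] /= ->] := laurentP y.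
have -> : of_poly p * lqV ^+ n * (of_poly r * lqV ^+ m) =
  of_poly (p * r) * lqV ^+ (n + m) by rewrite rmorphM exprD mulrACA.
by rewrite !lbarE rmorphM exprD mulrACA.
Qed.
HB.instance Definition _ :=
  GRing.isZmodMorphism.Build laurent laurent lbar lbar_zmod.
HB.instance Definition _ :=
  GRing.isMonoidMorphism.Build laurent laurent lbar lbar_monoid.

Lemma lbar_q : lbar lq = lqV.
Proof. by rewrite -[lq]mulr1 -(expr0 lqV) [lbar _](lbarE 'X 0) eval_lqVX mulr1. Qed.

Lemma lbar_qV : lbar lqV = lq.
Proof. by have := lbarE 1 1; rewrite !rmorph1 !mul1r. Qed.

Lemma lbarK : involutive lbar.
Proof.
move=> x; have [[p n] /= ->] := laurentP x.
rewrite lbarE rmorphM rmorphXn /= lbar_q; congr (_ * _).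
elim/poly_ind: p => [|p c IHp]; first by rewrite !rmorph0.
rewrite !rmorphD !rmorphM /= IHp eval_lqVX lbar_qV -/lq; congr (_ + _).
by rewrite -[c]intz !rmorph_int.
Qed.

Definition is_order (W : groupType) (x : W) (n : nat) : Prop :=
  [/\ (0 < n)%N, (x ^+ n)%g = 1%g &
      forall k, (0 < k < n)%N -> (x ^+ k)%g <> 1%g].

Section Coxeter.
Variables (W : groupType) (S : set W).

Definition word_prod (u : seq S) : W := (\prod_(s <- u) val s)%g.

(* The congruence on words generated by (s t)^m(s,t) ~ 1, where m(s,t) is the
   order of st, for all s, t with m(s,t) finite.  The case s = t gives s^2 ~ 1,
   so the quotient monoid is already the group presented by these relations. *)
Inductive cox_equiv : seq S -> seq S -> Prop :=
| cox_refl u : cox_equiv u u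
| cox_sym u v : cox_equiv u v -> cox_equiv v u
| cox_trans u v x : cox_equiv u v -> cox_equiv v x -> cox_equiv u x
| cox_cat u u' v v' :
    cox_equiv u u' -> cox_equiv v v' -> cox_equiv (u ++ v) (u' ++ v')
| cox_relator s t n : is_order (val s * val t)%g n ->
    cox_equiv (flatten (nseq n [:: s; t])) [::].

Record coxeter_system : Prop := {
  cox_order2 : forall s : S, is_order (val s) 2;
  cox_gen : forall w, exists u, word_prod u = w;
  cox_pres : forall u v, word_prod u = word_prod v -> cox_equiv u v }.

Definition has_word (w : W) (n : nat) : bool :=
  `[< exists u, size u = n /\ word_prod u = w >].

(* The value 0 when w has no expression is never used: S generates W. *)
Definition length (w : W) : nat :=
  if pselect (exists n, has_word w n) is left ex then ex_minn ex else 0%N.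

Definition bruhat_step (u w : W) : Prop :=
  (length u <= length w)%N /\
  exists t : W, (t = 1%g \/ exists (s : S) (x : W), t = (val s ^ x)%g) /\
                w = (t * u)%g.

Definition bruhat_le : W -> W -> Prop := clos_trans W bruhat_step.
Definition bruhat_lt (u w : W) : Prop := bruhat_le u w /\ u <> w.

(* l(w u^-1) = l(w) - l(u), without truncated subtraction. *)
Definition weak_le (u w : W) : Prop :=
  (length (w * u^-1)%g + length u)%N = length w.

(* Subsets J of S are sets over the subtype S. *)
Definition minrep (J : set S) : set W :=
  [set w | forall s : S, J s -> (length w < length (w * val s)%g)%N].

Section Descents.
Variables (I : set W) (J : set S) (w : W).

Definition SA : set S :=
  [set s | bruhat_lt w (val s * w)%g /\ I (val s * w)%g].
Definition SD : set S := [set s | bruhat_lt (val s * w)%g w].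
Definition WA : set S :=
  [set s | bruhat_lt w (val s * w)%g /\
           (minrep J `\` I)%classic (val s * w)%g].
Definition WD : set S :=
  [set s | bruhat_lt w (val s * w)%g /\ ~ minrep J (val s * w)%g].
Definition descents : set S := (SD `|` WD)%classic.

End Descents.

Definition Rset (I : set W) (J : set S) (s : S) (w : W) : set W :=
  [set y | [/\ I y, bruhat_lt y w & descents J y s]].

(* s t s t ..., n factors *)
Fixpoint alt_word (s t : S) (n : nat) : seq S :=
  if n is n'.+1 then s :: alt_word t s n' else [::].

End Coxeter.

(* The A-algebra presented by the T_s, subject to the quadratic and braid
   relations, is built as terms in scalars and generators modulo the least
   congruence containing the algebra axioms and these relations. *)

Section Hecke.
Variables (W : groupType) (S : set W).

Inductive hterm :=
| HConst of laurent
| HGen of S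
| HAdd of hterm & hterm
| HMul of hterm & hterm.

Definition hword (u : seq S) : hterm :=
  foldr HMul (HConst 1) [seq HGen s | s <- u].

Inductive hequiv : hterm -> hterm -> Prop :=
| heq_refl x : hequiv x x
| heq_sym x y : hequiv x y -> hequiv y x
| heq_trans x y z : hequiv x y -> hequiv y z -> hequiv x z
| heq_add x x' y y' :
    hequiv x x' -> hequiv y y' -> hequiv (HAdd x y) (HAdd x' y')
| heq_mul x x' y y' :
    hequiv x x' -> hequiv y y' -> hequiv (HMul x y) (HMul x' y')
| heq_addA x y z : hequiv (HAdd x (HAdd y z)) (HAdd (HAdd x y) z)
| heq_addC x y : hequiv (HAdd x y) (HAdd y x)
| heq_add0 x : hequiv (HAdd (HConst 0) x) x
| heq_addN x : hequiv (HAdd (HMul (HConst (-1)) x) x) (HConst 0)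
| heq_mulA x y z : hequiv (HMul x (HMul y z)) (HMul (HMul x y) z)
| heq_mul1l x : hequiv (HMul (HConst 1) x) x
| heq_mul1r x : hequiv (HMul x (HConst 1)) x
| heq_mulDl x y z : hequiv (HMul (HAdd x y) z) (HAdd (HMul x z) (HMul y z))
| heq_mulDr x y z : hequiv (HMul x (HAdd y z)) (HAdd (HMul x y) (HMul x z))
| heq_constD a b : hequiv (HConst (a + b)) (HAdd (HConst a) (HConst b))
| heq_constM a b : hequiv (HConst (a * b)) (HMul (HConst a) (HConst b))
| heq_central a x : hequiv (HMul (HConst a) x) (HMul x (HConst a))
| heq_quad s : hequiv (HMul (HGen s) (HGen s))
    (HAdd (HConst 1) (HMul (HConst (lq - lqV)) (HGen s)))
| heq_braid s t n : is_order (val s * val t)%g n ->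
    hequiv (hword (alt_word s t n)) (hword (alt_word t s n)).

HB.instance Definition _ := gen_eqMixin hterm.
HB.instance Definition _ := gen_choiceMixin hterm.

Definition hequivb (x y : hterm) : bool := `[< hequiv x y >].

Fact hequivb_refl : reflexive hequivb.
Proof. by move=> x; apply/asboolP; exact: heq_refl. Qed.
Fact hequivb_sym : symmetric hequivb.
Proof. by move=> x y; apply/asboolP/asboolP; exact: heq_sym. Qed.
Fact hequivb_trans : transitive hequivb.
Proof.
move=> y x z /asboolP xy /asboolP yz; apply/asboolP; exact: heq_trans xy yz.
Qed.
Canonical hequivb_equiv :=
  EquivRel hequivb hequivb_refl hequivb_sym hequivb_trans.

Definition hecke : Type := {eq_quot hequivb}%qT.
HB.instance Definition _ : EqQuotient hterm hequivb hecke :=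
  EqQuotient.on hecke.
HB.instance Definition _ := Choice.on hecke.

Definition hpi (x : hterm) : hecke := \pi_hecke%qT x.

Lemma hpiE x y : hpi x = hpi y <-> hequiv x y.
Proof.
rewrite /hpi; split=> [/eqquotP|xy]; first by move/asboolP.
by apply/eqquotP/asboolP.
Qed.

Lemma hpi_surj (x : hecke) : exists t, x = hpi t.
Proof. by exists (repr x); rewrite /hpi reprK. Qed.

Lemma hpi_repr x : hequiv (repr (hpi x)) x.
Proof. by apply/hpiE; rewrite /hpi reprK. Qed.

Definition hadd (x y : hecke) : hecke := hpi (HAdd (repr x) (repr y)).
Definition hmul (x y : hecke) : hecke := hpi (HMul (repr x) (repr y)).
Definition hconst (a : laurent) : hecke := hpi (HConst a).
Definition hopp (x : hecke) : hecke := hmul (hconst (-1)) x.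

Lemma haddE x y : hadd (hpi x) (hpi y) = hpi (HAdd x y).
Proof. by apply/hpiE/heq_add; exact: hpi_repr. Qed.
Lemma hmulE x y : hmul (hpi x) (hpi y) = hpi (HMul x y).
Proof. by apply/hpiE/heq_mul; exact: hpi_repr. Qed.

Local Ltac by_terms :=
  rewrite ?/hopp ?/hconst;
  repeat (let x := fresh "x" in move=> x; have [? ->] := hpi_surj x);
  rewrite ?(haddE, hmulE); apply/hpiE.

Fact haddA : associative hadd. Proof. by by_terms; exact: heq_addA. Qed.
Fact haddC : commutative hadd. Proof. by by_terms; exact: heq_addC. Qed.
Fact hadd0 : left_id (hconst 0) hadd. Proof. by by_terms; exact: heq_add0. Qed.
Fact haddN : left_inverse (hconst 0) hopp hadd.
Proof. by by_terms; exact: heq_addN. Qed.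
HB.instance Definition _ :=
  GRing.isZmodule.Build hecke haddA haddC hadd0 haddN.

Fact hmulA : associative hmul. Proof. by by_terms; exact: heq_mulA. Qed.
Fact hmul1l : left_id (hconst 1) hmul. Proof. by by_terms; exact: heq_mul1l. Qed.
Fact hmul1r : right_id (hconst 1) hmul. Proof. by by_terms; exact: heq_mul1r. Qed.
Fact hmulDl : left_distributive hmul hadd.
Proof. by by_terms; exact: heq_mulDl. Qed.
Fact hmulDr : right_distributive hmul hadd.
Proof. by by_terms; exact: heq_mulDr. Qed.

Section Lift.
Variables (B : pzRingType) (f : {rmorphism laurent -> B}) (t : S -> B).
Hypothesis f_central : forall a x, f a * x = x * f a.
Hypothesis t_quad : forall s, t s * t s = 1 + f (lq - lqV) * t s.
Hypothesis t_braid : forall s s' n, is_order (val s * val s')%g n ->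
  \prod_(i <- alt_word s s' n) t i = \prod_(i <- alt_word s' s n) t i.

Fixpoint heval (x : hterm) : B :=
  match x with
  | HConst a => f a
  | HGen s => t s
  | HAdd x y => heval x + heval y
  | HMul x y => heval x * heval y
  end.

Lemma heval_word u : heval (hword u) = \prod_(i <- u) t i.
Proof.
elim: u => [|s u IHu] /=; first by rewrite big_nil rmorph1.
by rewrite big_cons -IHu.
Qed.

Lemma heval_equiv x y : hequiv x y -> heval x = heval y.
Proof.
elim=> {x y} //=.
- by move=> *; congruence.
- by move=> x x' y y' _ -> _ ->.
- by move=> x x' y y' _ -> _ ->.
- by move=> x y z; rewrite addrA.
- by move=> x y; rewrite addrC.
- by move=> x; rewrite rmorph0 add0r.
- by move=> x; rewrite rmorphN rmorph1 mulN1r addNr rmorph0.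
- by move=> x y z; rewrite mulrA.
- by move=> x; rewrite rmorph1 mul1r.
- by move=> x; rewrite rmorph1 mulr1.
- by move=> x y z; rewrite mulrDl.
- by move=> x y z; rewrite mulrDr.
- by move=> a b; rewrite rmorphD.
- by move=> a b; rewrite rmorphM.
- by move=> s; rewrite rmorph1 t_quad.
- by move=> s s' n ?; rewrite !heval_word; exact: t_braid.
Qed.

Definition hlift (x : hecke) : B := heval (repr x).

Lemma hlift_pi x : hlift (hpi x) = heval x.
Proof. by apply: heval_equiv; exact: hpi_repr. Qed.

Lemma hlift_const a : hlift (hconst a) = f a.
Proof. exact: hlift_pi. Qed.

Lemma hliftD x y : hlift (hadd x y) = hlift x + hlift y.
Proof. by rewrite hlift_pi. Qed.

Lemma hliftM x y : hlift (hmul x y) = hlift x * hlift y.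
Proof. by rewrite hlift_pi. Qed.

End Lift.

(* The character T_s |-> -q^-1 shows that the algebra is not zero. *)
Fact hone_neq0 : hconst 1 != hconst 0.
Proof.
pose t (_ : S) : laurent := - lqV.
have tq s : t s * t s = 1 + idfun (lq - lqV) * t s.
  by rewrite /t mulrNN /= mulrN mulrBl lqK opprB addrC subrK.
have tb s s' n : is_order (val s * val s')%g n ->
    \prod_(i <- alt_word s s' n) t i = \prod_(i <- alt_word s' s n) t i.
  move=> _; elim: n s s' => [|n IHn] s s' /=; first by rewrite !big_nil.
  by rewrite !big_cons IHn.
apply/eqP => /(congr1 (hlift idfun t)).
rewrite !hlift_const //; try by [move=> *; exact: mulrC].
by move/eqP; rewrite oner_eq0.
Qed.

HB.instance Definition _ := GRing.Zmodule_isNzRing.Build hecke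
  hmulA hmul1l hmul1r hmulDl hmulDr hone_neq0.

Fact hconst_zmod : zmod_morphism hconst.
Proof.
move=> a b; apply/hpiE/(heq_trans (heq_constD _ _))/hpiE.
rewrite -haddE; apply: (congr1 (hadd (hpi _))).
rewrite -[- b in LHS]mulN1r [RHS]hmulE; exact/hpiE/heq_constM.
Qed.
Fact hconst_monoid : monoid_morphism hconst.
Proof. by split=> // a b; rewrite [RHS]hmulE; exact/hpiE/heq_constM. Qed.
HB.instance Definition _ :=
  GRing.isZmodMorphism.Build laurent hecke hconst hconst_zmod.
HB.instance Definition _ :=
  GRing.isMonoidMorphism.Build laurent hecke hconst hconst_monoid.

Fact hconst_central (a : laurent) (x : hecke) : hconst a * x = x * hconst a.
Proof.
have [t ->] := hpi_surj x; rewrite [LHS]hmulE [RHS]hmulE.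
exact/hpiE/heq_central.
Qed.

Definition hscale (a : laurent) (x : hecke) : hecke := hconst a * x.

Fact hscaleA a b x : hscale a (hscale b x) = hscale (a * b) x.
Proof. by rewrite /hscale rmorphM mulrA. Qed.
Fact hscale1 : left_id 1 hscale.
Proof. by move=> x; rewrite /hscale rmorph1 mul1r. Qed.
Fact hscaleDr : right_distributive hscale +%R.
Proof. by move=> a x y; rewrite /hscale mulrDr. Qed.
Fact hscaleDl x : {morph hscale^~ x : a b / a + b}.
Proof. by move=> a b; rewrite /hscale rmorphD mulrDl. Qed.
HB.instance Definition _ := GRing.Zmodule_isLmodule.Build laurent hecke
  hscaleA hscale1 hscaleDr hscaleDl.

Fact hscaleAl (a : laurent) (x y : hecke) : a *: (x * y) = (a *: x) * y.
Proof. exact: mulrA. Qed.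
HB.instance Definition _ :=
  GRing.Lmodule_isLalgebra.Build laurent hecke hscaleAl.

Fact hscaleAr (a : laurent) (x y : hecke) : a *: (x * y) = x * (a *: y).
Proof.
by rewrite -[RHS]/(x * (hconst a * y)) mulrA -hconst_central -mulrA.
Qed.
HB.instance Definition _ :=
  GRing.Lalgebra_isAlgebra.Build laurent hecke hscaleAr.

Lemma hconstE a : hconst a = a%:A. Proof. exact/esym/mulr1. Qed.

Definition hT (s : S) : hecke := hpi (HGen s).

Lemma hT_word u : hpi (hword u) = \prod_(i <- u) hT i.
Proof.
elim: u => [|s u IHu] /=; first by rewrite big_nil.
by rewrite big_cons -IHu [RHS]hmulE.
Qed.

Lemma hT_quad s : hT s * hT s = 1 + (lq - lqV) *: hT s.
Proof.
rewrite [LHS]hmulE -[_ *: _]/(hmul (hconst _) (hT s)) hmulE [RHS]haddE.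
exact/hpiE/heq_quad.
Qed.

Lemma hT_braid s s' n : is_order (val s * val s')%g n ->
  \prod_(i <- alt_word s s' n) hT i = \prod_(i <- alt_word s' s n) hT i.
Proof. by move=> o; rewrite -!hT_word; exact/hpiE/heq_braid. Qed.

Definition hTV (s : S) : hecke := hT s - (lq - lqV)%:A.

Lemma hTK s : hT s * hTV s = 1.
Proof. by rewrite mulrBr hT_quad -scalerAr mulr1 addrK. Qed.

Lemma hTVK s : hTV s * hT s = 1.
Proof. by rewrite mulrBl hT_quad -scalerAl mul1r addrK. Qed.

Definition hbar : hecke -> hecke := hlift (hconst \o lbar) hTV.

Fact hbar_central (a : laurent) (x : hecke) :
  (hconst \o lbar) a * x = x * (hconst \o lbar) a.
Proof. exact: hconst_central. Qed.

Fact hbar_quad s :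
  hTV s * hTV s = 1 + (hconst \o lbar) (lq - lqV) * hTV s.
Proof.
rewrite /= rmorphB /= lbar_q lbar_qV.
have -> : hconst (lqV - lq) * hTV s = - ((lq - lqV) *: hTV s).
  by rewrite -opprB rmorphN mulNr.
by rewrite {2}/hTV mulrBr hTVK -scalerAr mulr1.
Qed.

Lemma hTV_word (u : seq S) :
  \prod_(i <- u) hTV i * \prod_(i <- rev u) hT i = 1.
Proof.
elim: u => [|s u IHu]; first by rewrite !big_nil mulr1.
rewrite rev_cons big_cons -cats1 big_cat big_seq1 /= mulrA -[_ * _ * \prod_(_ <- rev u) _]mulrA.
by rewrite IHu mulr1 hTVK.
Qed.

Lemma hT_revK (u : seq S) :
  \prod_(i <- rev u) hT i * \prod_(i <- u) hTV i = 1.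
Proof.
elim: u => [|s u IHu]; first by rewrite !big_nil mulr1.
rewrite rev_cons big_cons -cats1 big_cat big_seq1 /= -mulrA [hT s * _]mulrA.
by rewrite hTK mul1r.
Qed.

Lemma alt_word_rcons (s s' : S) n :
  alt_word s s' n.+1 = rcons (alt_word s s' n) (if odd n then s' else s).
Proof.
elim: n s s' => [|n IHn] s s' //.
by rewrite -[LHS]/(s :: alt_word s' s n.+1) IHn /=; case: (odd n).
Qed.

Lemma rev_alt_word (s s' : S) n :
  rev (alt_word s s' n) = if odd n then alt_word s s' n else alt_word s' s n.
Proof.
elim: n s s' => // n IHn s s'.
by rewrite [in LHS]alt_word_rcons rev_rcons IHn /=; case: (odd n).
Qed.

Fact hbar_braid s s' n : is_order (val s * val s')%g n ->
  \prod_(i <- alt_word s s' n) hTV i = \prod_(i <- alt_word s' s n) hTV i.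
Proof.
move=> o; set x := LHS; set y := RHS.
have xK : x * \prod_(i <- alt_word s s' n) hT i = 1.
  rewrite -[RHS](hTV_word (alt_word s s' n)) rev_alt_word.
  by case: odd; rewrite // hT_braid.
have yK : \prod_(i <- alt_word s s' n) hT i * y = 1.
  rewrite -[RHS](hT_revK (alt_word s' s n)) rev_alt_word.
  by case: odd; rewrite // hT_braid.
by rewrite -[x]mulr1 -yK mulrA xK mul1r.
Qed.

Lemma hbar_T s : hbar (hT s) = hTV s.
Proof. exact: (hlift_pi hbar_central hbar_quad hbar_braid). Qed.

Lemma hbar_scalar a : hbar a%:A = (lbar a)%:A.
Proof.
rewrite -!hconstE.
exact: (hlift_const hbar_central hbar_quad hbar_braid).
Qed.

Lemma hbarD : {morph hbar : x y / x + y}.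
Proof. exact: (hliftD hbar_central hbar_quad hbar_braid). Qed.

Lemma hbarM : {morph hbar : x y / x * y}.
Proof. exact: (hliftM hbar_central hbar_quad hbar_braid). Qed.

Lemma hbarK : involutive hbar.
Proof.
move=> x; have [t ->] := hpi_surj x; elim: t => [a|s|x1 IH1 x2 IH2|x1 IH1 x2 IH2].
- by rewrite -[hpi _]/(hconst a) hconstE !hbar_scalar lbarK.
- have hbarN y : hbar (- y) = - hbar y.
    by rewrite -mulN1r hbarM -[-1]scaleN1r hbar_scalar rmorphN rmorph1 scaleN1r mulN1r.
  rewrite hbar_T {1}/hTV hbarD hbarN hbar_T hbar_scalar rmorphB /= lbar_q lbar_qV.
  by rewrite /hTV -[lqV - lq]opprB scaleNr opprK subrK.
- by rewrite -haddE -[hadd _ _]/(hpi x1 + hpi x2) !hbarD IH1 IH2.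
- by rewrite -hmulE -[hmul _ _]/(hpi x1 * hpi x2) !hbarM IH1 IH2.
Qed.

End Hecke.

(* An H-module is an A-module by restriction of scalars along A -> H. *)
Definition ascale (W : groupType) (S : set W) (M : lmodType (hecke S))
  (a : laurent) (m : M) : M := a%:A *: m.

Notation "a *:: m" := (ascale a m) (at level 40, left associativity).

(* (b_w | w in I) is an A-basis of M; b is irrelevant outside I. *)
Definition is_basis (W : groupType) (S : set W) (M : lmodType (hecke S))
    (I : set W) (b : W -> M) : Prop :=
  (forall (X : seq W) (f : W -> laurent), uniq X -> (forall w, w \in X -> I w) ->
     \sum_(w <- X) f w *:: b w = 0 -> forall w, w \in X -> f w = 0) /\
  (forall m : M, exists (X : seq W) (f : W -> laurent),
     (forall w, w \in X -> I w) /\ m = \sum_(w <- X) f w *:: b w).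

(* I is a W-graph ideal with respect to J, with module M, basis b and
   semilinear involution bar.  The sums over {y in I | y < sw} are finite
   because Bruhat intervals are. *)
Record wgraph_ideal (W : groupType) (S : set W) (I : set W) (J : set S)
    (M : lmodType (hecke S)) (b : W -> M) (bar : M -> M) : Prop := {
  wg_ideal : forall u w, I w -> weak_le S u w -> I u;
  wg_minrep : (I `<=` minrep J)%classic;
  wg_basis : is_basis I b;
  wg_SA : forall s w, I w -> SA I w s ->
    hT s *: b w = b (val s * w)%g;
  wg_SD : forall s w, I w -> SD w s ->
    hT s *: b w = b (val s * w)%g + (lq - lqV) *:: b w;
  wg_WD : forall s w, I w -> WD J w s ->
    hT s *: b w = - lqV *:: b w;
  wg_WA : forall s w, I w -> WA I J w s ->
    exists r : W -> {poly int},
      (forall y, exists r' : {poly int}, r y = 'X * r') /\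
      hT s *: b w = lq *:: b w -
        \sum_(y \in [set y | I y /\ bruhat_lt S y (val s * w)%g])
          of_poly (r y) *:: b y;
  wg_one : I 1%g;
  wg_barD : {morph bar : x y / x + y};
  wg_barZ : forall (a : laurent) m, bar (a *:: m) = lbar a *:: bar m;
  wg_barK : involutive bar;
  wg_bar1 : bar (b 1%g) = b 1%g;
  wg_bar_hecke : forall (h : hecke S) m, bar (h *: m) = hbar h *: bar m }.

(* b_w = c_w + q sum_(y in I, y < w) q_(y,w) c_y with q_(y,w) = Q y w in Z[q]. *)
Record wgraph_basis (W : groupType) (S : set W) (I : set W)
    (M : lmodType (hecke S)) (b : W -> M) (bar : M -> M)
    (c : W -> M) (Q : W -> W -> {poly int}) : Prop := {
  wb_basis : is_basis I c;
  wb_bar : forall w, I w -> bar (c w) = c w;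
  wb_b : forall w, I w ->
    b w = c w + lq *:: \sum_(y \in [set y | I y /\ bruhat_lt S y w])
                        of_poly (Q y w) *:: c y }.

Definition mu (W : Type) (Q : W -> W -> {poly int}) (y w : W) : int :=
  (Q y w)`_0.

(* Main.v *)
Require Import Defs.
From Stdlib Require Import Relation_Operators.
From mathcomp Require Import all_boot all_order all_algebra.
From mathcomp Require Import finmap.
From mathcomp Require Import boolp classical_sets cardinality fsbigop.

(** Why the multiplication formulas hold.

    Let L be the Z[q]-span of the basis (c_w).  A bar-invariant element of q L
    is zero, because its coordinates on the bar-invariant basis are
    polynomials divisible by q and fixed by q |-> q^-1
    ([bar_fixed_lattice1_eq0]).  So two bar-invariant elements are equal as
    soon as they are congruent modulo q L, and modulo q L each c_w may be
    replaced by b_w, on which T_s acts in a known way.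

    Both T_s - q and T_s + q^-1 are bar-invariant in the Hecke algebra, and
    their product is zero.  From the action on the b_y one reads off that
    q (T_s - q) b_y is congruent to - c_y if s is a descent of y and to 0
    otherwise, and induction on the length of y gives the same for c_y
    ([hTq_c]).  Hence, when b_w = c_w + q sum_y q_(y,w) c_y is solved for c_w
    and T_s - q is applied, only the constant terms mu_(y,w) of the q_(y,w)
    with s a descent of y survive modulo q L: (T_s - q) c_w is congruent to
    (T_s - q) b_w + sum mu_(y,w) c_y.  For an ascent s of w, (T_s - q) b_w is
    congruent to c_(sw) or to 0, so (T_s - q) c_w, itself bar-invariant, is
    congruent to a bar-invariant element and the last two formulas follow
    ([hTq_c_mod]), without induction on w.

    That (T_s + q^-1) c_w = 0 for a descent s of w is proved by induction on
    the length of w.  If sw < w, apply T_s + q^-1 to the formula for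
    (T_s - q) c_(sw), in which c_w occurs once, all other terms being killed
    by the induction hypothesis.  If s is a weak descent, T_s + q^-1 kills
    b_w; then, for z without descent s, the coordinate of (T_s + q^-1) c_w
    at z is - (q^2 + 1) q_(z,w), a polynomial which bar-invariance forces to
    be constant, so that q_(z,w) = 0 and again every term vanishes
    ([hTqV_WD]).

    The sums over y < w are meaningful because Bruhat intervals are finite.
    This is the subword property, which rests on the strong exchange condition.
    Exchange is obtained from the presentation of W: the parity with which
    the gallery of a word crosses the wall of a reflection t depends only on
    the element that the word represents, and an odd parity means that t can
    be absorbed by deleting a letter ([crossing_prod], [crossing_delete]). *)

Set Implicit Arguments.
Unset Strict Implicit.
Unset Printing Implicit Defensive.

Import GRing.Theory.
Local Open Scope ring_scope.

(** * Finiteness of Bruhat intervals *)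

Section CoxeterGroup.
Local Open Scope group_scope.
Variables (W : groupType) (S : set W).
Hypothesis coxS : coxeter_system S.

(** The word s1 ... sn traces a gallery of chambers whose i-th wall belongs to
    the reflection s1 ... s(i-1) si s(i-1) ... s1; this is the parity of the
    number of times t occurs among these reflections.  The recursive call
    moves the base point along the first letter. *)
Fixpoint crossing (u : seq S) (t : W) : bool :=
  if u is s :: u' then (t == val s) (+) crossing u' (t ^ val s) else false.

Lemma word_prod_cat (u v : seq S) :
  word_prod (u ++ v) = word_prod u * word_prod v.
Proof. by rewrite /word_prod big_cat. Qed.

Lemma word_prod_cons s (u : seq S) :
  word_prod (s :: u) = val s * word_prod u.
Proof. by rewrite /word_prod big_cons. Qed.

Lemma word_prod_nil : word_prod (Nil S) = 1.
Proof. by rewrite /word_prod big_nil. Qed.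

Lemma gen_sq (s : S) : val s * val s = 1.
Proof. by have [_ + _] := cox_order2 coxS s; rewrite expg2. Qed.

Lemma genV (s : S) : (val s)^-1 = val s.
Proof. by apply: (mulgI (val s)); rewrite mulgV gen_sq. Qed.

Lemma genK (s : S) x : val s * (val s * x) = x.
Proof. by rewrite mulgA gen_sq mul1g. Qed.

Lemma gen_neq1 (s : S) : val s <> 1.
Proof. by have [_ _ /(_ 1%N isT)] := cox_order2 coxS s; rewrite expg1. Qed.

Lemma crossing_cat u v t :
  crossing (u ++ v) t = crossing u t (+) crossing v (t ^ word_prod u).
Proof.
elim: u t => [|s u IHu] t /=; first by rewrite word_prod_nil conjg1.
by rewrite IHu word_prod_cons conjgM addbA.
Qed.

(** With r = st, the walls met by the word (st)^n belong to the elements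
    r^j s for j < 2n.  If moreover r^n = 1, the second half of this list
    repeats the first, so each of them is met an even number of times. *)
Lemma crossing_power (s t : S) n x :
  crossing (flatten (nseq n [:: s; t])) x =
  \big[addb/false]_(j < n.*2) (x == (val s * val t) ^+ j * val s).
Proof.
set r := val s * val t.
have rV : r^-1 = val t * val s by rewrite invgM !genV.
elim: n x => [|n IHn] x; first by rewrite big_ord0.
rewrite doubleS !big_ord_recl /= IHn expg0 mul1g expg1.
congr (_ (+) (_ (+) _)).
  rewrite conjgE genV -(inj_eq (mulgI (val s))) genK.
  by rewrite -(inj_eq (mulIg (val s))) -mulgA gen_sq mulg1 /r -!mulgA.
apply: eq_bigr => j _; rewrite /bump /= !add1n -conjgM -/r.
rewrite conjgE -(inj_eq (mulgI r)) mulVKg -(inj_eq (mulIg r^-1)) mulgK.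
congr (x == _); rewrite expgSr expgS -!mulgA; congr (_ * (_ * _)).
by rewrite rV.
Qed.

Lemma crossing_relator (s t : S) n x :
  is_order (val s * val t) n -> crossing (flatten (nseq n [:: s; t])) x = false.
Proof.
move=> [_ rn _]; rewrite crossing_power -addnn big_split_ord /=.
under [X in _ (+) X]eq_bigr do rewrite expgnDr rn mul1g.
by rewrite addbb.
Qed.

(** Congruent words have the same parities: this holds for the relators and
    is inherited by the whole congruence, since the parities of u ++ v depend
    only on those of u and v and on the product of u. *)
Lemma cox_equiv_crossing (u v : seq S) : cox_equiv u v ->
  word_prod u = word_prod v /\ crossing u =1 crossing v.
Proof.
elim=> {u v} [//|u v _ [-> uv]|u v x _ [-> uv] _ [-> vx]|
  u u' v v' _ [eu uu] _ [ev vv]|s t n o].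
- by split.
- by split=> // y; rewrite uv.
- by rewrite !word_prod_cat eu ev; split=> // y; rewrite !crossing_cat uu vv eu.
- split=> [|x]; last by rewrite crossing_relator.
  have [_ rn _] := o; rewrite word_prod_nil -[RHS]rn.
  elim: (n) => [|k IHk]; first exact: word_prod_nil.
  by rewrite expgS -IHk /= !word_prod_cons mulgA.
Qed.

Lemma crossing_prod (u v : seq S) t :
  word_prod u = word_prod v -> crossing u t = crossing v t.
Proof. by move=> /(cox_pres coxS)/cox_equiv_crossing[]. Qed.

(** Multiplying by the reflection of the i-th wall deletes the i-th letter. *)
Lemma crossing_delete (u : seq S) t : crossing u t ->
  exists v, [/\ subseq v u, (size v < size u)%N &
                word_prod v = t * word_prod u].
Proof.
elim: u t => //= s u IHu t; case: eqP => [-> _|_ /= /IHu[v [vu sz e]]].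
  by exists u; rewrite word_prod_cons genK; split=> //; exact: subseq_cons.
exists (s :: v); rewrite /= eqxx ltnS; split=> //.
by rewrite !word_prod_cons e conjgE genV -!mulgA genK.
Qed.

Definition reflection (t : W) := exists (s : S) (x : W), t = val s ^ x.

(** A palindromic word a1 ... an s an ... a1 for t meets the wall of t an odd
    number of times: surrounding a word by a letter adds two contributions
    that cancel. *)
Lemma crossing_reflection t : reflection t ->
  exists2 z, word_prod z = t & crossing z t.
Proof.
move=> [s [x ->]]; have [u <-] := cox_gen coxS x.
elim/last_ind: u => [|u a [z ze zt]].
  exists [:: s]; first by rewrite word_prod_cons !word_prod_nil conjg1 mulg1.
  by rewrite /= word_prod_nil conjg1 eqxx.
rewrite -cats1 word_prod_cat word_prod_cons word_prod_nil mulg1 conjgM.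
set r := val s ^ word_prod u in ze zt *.
have tK : (r ^ val a) ^ val a = r by rewrite -conjgM gen_sq conjg1.
exists (a :: z ++ [:: a]).
  by rewrite word_prod_cons word_prod_cat word_prod_cons word_prod_nil ze mulg1
             conjgE genV.
rewrite /= tK crossing_cat zt ze /= [r ^ r]conjgE mulKg addbF.
(* The first and the last letter meet the wall of r ^ a under the same
   condition. *)
rewrite (_ : (r ^ val a == val a) = (r == val a)); first by case: eqP.
rewrite -[in RHS](inj_eq (@conjg_inj _ (val a))); congr (_ == _).
by rewrite conjgE mulKg.
Qed.

Lemma reflection_sq t : reflection t -> t * t = 1.
Proof. by move=> [s [x ->]]; rewrite -conjMg gen_sq conj1g. Qed.

Lemma reflectionK t x : reflection t -> t * (t * x) = x.
Proof. by move=> tR; rewrite mulgA reflection_sq // mul1g. Qed.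

Lemma length_le (u : seq S) : (length S (word_prod u) <= size u)%N.
Proof.
rewrite /length; case: pselect => // ex; case: ex_minnP => n _; apply.
by apply/asboolP; exists u.
Qed.

Lemma reduced_word w : exists2 u : seq S, word_prod u = w & size u = length S w.
Proof.
rewrite /length; case: pselect => [ex|[]]; last first.
  by have [u uw] := cox_gen coxS w; exists (size u); apply/asboolP; exists u.
by case: ex_minnP => n /asboolP[u [<- <-]] _; exists u.
Qed.

Lemma crossing_shorter (u : seq S) t : crossing u t ->
  (length S (t * word_prod u) < length S (word_prod u))%N.
Proof.
have [r re <-] := reduced_word (word_prod u).
rewrite -(crossing_prod t re) -re => /crossing_delete[v [_ sz <-]].
exact: leq_ltn_trans (length_le v) sz.
Qed.

(** Prefixing u by a word for t switches the parity at t, so this is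
    [crossing_shorter] for t w in place of w. *)
Lemma not_crossing_longer (u : seq S) t : reflection t -> ~~ crossing u t ->
  (length S (word_prod u) < length S (t * word_prod u))%N.
Proof.
move=> tR ut; have [z ze zt] := crossing_reflection tR.
have := @crossing_shorter (z ++ u) t.
rewrite crossing_cat zt word_prod_cat ze conjgE mulKg (negPf ut) reflectionK //.
exact.
Qed.

(** Strong exchange: a reflection that does not lengthen w has odd parity in
    every word for w, reduced or not, hence deletes one of its letters. *)
Lemma bruhat_step_subword x (u : seq S) : bruhat_step S x (word_prod u) ->
  exists2 v, subseq v u & word_prod v = x.
Proof.
move=> [le [t [[->|tR] e]]]; first by exists u; rewrite // e mul1g.
have xe : x = t * word_prod u by rewrite e reflectionK.
have [|ut] := boolP (crossing u t).
  by move=> /crossing_delete[v [vu _ ve]]; exists v; rewrite // xe.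
by have := not_crossing_longer tR ut; rewrite -xe ltnNge le.
Qed.

Lemma bruhat_subword x w : bruhat_le S x w ->
  forall u : seq S, word_prod u = w -> exists2 v, subseq v u & word_prod v = x.
Proof.
elim=> {x w} [x w + u ue|x y w _ IHxy _ IHyw u /IHyw[v vu /IHxy[v' v'v <-]]].
  by rewrite -ue; exact: bruhat_step_subword.
by exists v' => //; exact: subseq_trans vu.
Qed.

(** A word has finitely many subwords. *)
Lemma bruhat_interval_finite w : finite_set [set x | bruhat_le S x w].
Proof.
have [u uw] := cox_gen coxS w.
pose sub (m : (size u).-tuple bool) := word_prod (mask m u).
apply: (@sub_finite_set _ _ (sub @` setT)%classic).
  move=> x /bruhat_subword/(_ u uw)[v /subseqP[m sm ->] <-].
  by exists (Tuple (introT eqP sm)).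
exact/finite_image/finite_finset.
Qed.

(** The defining steps allow equal lengths; a reflection always changes the
    length, so equality occurs only for the trivial step. *)
Lemma bruhat_le_length x w : bruhat_le S x w ->
  x = w \/ (length S x < length S w)%N.
Proof.
elim=> {x w} [x w|x y w _ [->//|xy] _ [<-|yw]]; last 2 first.
- by right.
- by right; exact: ltn_trans xy yw.
move=> [le [t [[->|tR] e]]]; first by left; rewrite e mul1g.
right; have [u ux] := cox_gen coxS x; rewrite e -ux.
have [ut|] := boolP (crossing u t); last exact: not_crossing_longer.
by have := crossing_shorter ut; rewrite ux -e ltnNge le.
Qed.

Lemma bruhat_lt_length x w : bruhat_lt S x w -> (length S x < length S w)%N.
Proof. by move=> [/bruhat_le_length[]]. Qed.

Lemma gen_neq (s : S) w : val s * w <> w.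
Proof. by rewrite -[X in _ <> X]mul1g => /mulIg/gen_neq1. Qed.

Lemma bruhat_lt_gen (s : S) w : (length S w <= length S (val s * w))%N ->
  bruhat_lt S w (val s * w).
Proof.
move=> le; split; last by move/esym/gen_neq.
apply: t_step; split=> //; exists (val s); split=> //; right.
by exists s, 1; rewrite conjg1.
Qed.

Lemma bruhat_lt_genP (s : S) w :
  bruhat_lt S w (val s * w) \/ bruhat_lt S (val s * w) w.
Proof.
have [le|/ltnW le] := leqP (length S w) (length S (val s * w)).
  by left; exact: bruhat_lt_gen.
by right; rewrite -{2}[w](genK s); apply: bruhat_lt_gen; rewrite genK.
Qed.

Lemma length_gen (s : S) : length S (val s) = 1%N.
Proof.
have e : word_prod [:: s] = val s by rewrite word_prod_cons word_prod_nil mulg1.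
apply/eqP; rewrite eqn_leq -{1}e length_le /= lt0n; apply/eqP => l0.
have [u us] := reduced_word (val s); rewrite l0 => /size0nil u0.
by apply: (@gen_neq1 s); rewrite -us u0 word_prod_nil.
Qed.

Lemma length_gen_mul (s : S) w : (length S (val s * w) <= (length S w).+1)%N.
Proof.
have [u <- <-] := reduced_word w; rewrite -word_prod_cons.
exact: (length_le (s :: u)).
Qed.

Lemma weak_le_descent (s : S) w : bruhat_lt S (val s * w) w ->
  weak_le S (val s * w) w.
Proof.
move=> /bruhat_lt_length lt; apply/eqP.
rewrite invgM genV mulVKg length_gen add1n eqn_leq lt.
by rewrite -{1}[w](genK s) length_gen_mul.
Qed.

End CoxeterGroup.

(** * The bar involution on polynomials *)

Lemma of_poly_int (k : int) : of_poly k%:P = k%:~R.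
Proof. by rewrite -[k in LHS]intz !rmorph_int. Qed.

(** Up to a power of q, substituting q^-1 in a polynomial reverses the list of
    its coefficients. *)
Lemma eval_lqV_reverse (p : {poly int}) n : (size p <= n.+1)%N ->
  exists2 r : {poly int}, (size r <= n.+1)%N &
    eval_lqV p * lq ^+ n = of_poly r.
Proof.
move=> pn; exists (\sum_(i < n.+1) p`_i *: 'X^(n - i)).
  apply: (big_ind (fun r : {poly int} => (size r <= n.+1)%N)).
  - by rewrite size_poly0.
  - move=> x y xn yn; apply: leq_trans (size_polyD _ _) _.
    by rewrite geq_max xn.
  - move=> i _; apply: leq_trans (size_scale_leq _ _) _.
    by rewrite size_polyXn ltnS leq_subr.
have -> : eval_lqV p = \sum_(i < n.+1) (p`_i)%:~R * lqV ^+ i.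
  rewrite /eval_lqV (horner_coef_wide _ (leq_trans (size_poly _ _) pn)).
  by apply: eq_bigr => i _; rewrite coef_map.
rewrite mulr_suml rmorph_sum /=; apply: eq_bigr => i _.
rewrite -mul_polyC rmorphM rmorphXn /= -/lq of_poly_int -mulrA; congr (_ * _).
have le : (i <= n)%N by rewrite -ltnS.
have -> : lq ^+ n = lq ^+ (n - i) * lq ^+ i by rewrite -exprD subnK.
by rewrite mulrCA [lqV ^+ _ * _]mulrC lqXK mulr1.
Qed.

(** If p(q^-1) = p(q) with p of degree d, then q^d p(q) is the reversed
    polynomial of p, whose degree is at most d; so d = 0. *)
Lemma lbar_of_poly_fixed (p : {poly int}) :
  lbar (of_poly p) = of_poly p -> exists k : int, p = k%:P.
Proof.
have -> : lbar (of_poly p) = eval_lqV p.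
  by rewrite -[of_poly p]mulr1 -(expr0 lqV) lbarE mulr1.
move=> fix_p; have [le1|lt1] := leqP (size p) 1.
  by exists p`_0; rewrite -size1_polyC.
have p0 : p != 0 by rewrite -size_poly_gt0 ltnW.
have [r] := eval_lqV_reverse (leqSpred (size p)).
rewrite (prednK (ltnW lt1)) fix_p -/lq -rmorphXn -rmorphM /=.
move=> rn /of_poly_inj e.
move: rn; rewrite -e size_mulXn // leqNgt -{1}(add0n (size p)) ltn_add2r.
by rewrite -ltnS (prednK (ltnW lt1)) lt1.
Qed.

(** * Coordinates over Z[q, q^-1] *)

Section Scalars.
Variables (W : groupType) (S : set W) (M : lmodType (hecke S)).
Implicit Types (m n : M) (a : laurent) (h : hecke S).

Lemma hecke_ascale h a m : h *: (a *:: m) = a *:: (h *: m).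
Proof. by rewrite /ascale !scalerA mulr_algr mulr_algl. Qed.

Lemma ascaleDr a m n : a *:: (m + n) = a *:: m + a *:: n.
Proof. exact: scalerDr. Qed.

Lemma ascaleDl a b m : (a + b) *:: m = a *:: m + b *:: m.
Proof. by rewrite /ascale !scalerDl. Qed.

Lemma ascaleNl a m : (- a) *:: m = - (a *:: m).
Proof. by rewrite /ascale !scaleNr. Qed.

Lemma ascaleNr a m : a *:: (- m) = - (a *:: m).
Proof. exact: scalerN. Qed.

Lemma ascaleBl a b m : (a - b) *:: m = a *:: m - b *:: m.
Proof. by rewrite ascaleDl ascaleNl. Qed.

Lemma ascaleA a b m : a *:: (b *:: m) = (a * b) *:: m.
Proof. by rewrite /ascale !scalerA mulr_algl scalerA. Qed.

Lemma ascale1 m : 1 *:: m = m.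
Proof. by rewrite /ascale !scale1r. Qed.

Lemma ascale0 m : 0 *:: m = 0.
Proof. by rewrite /ascale !scale0r. Qed.

Lemma ascale_int (k : int) m : k%:~R *:: m = m *~ k.
Proof. by rewrite /ascale !scaler_int. Qed.

Lemma ascale_sumr a (X : seq W) (P : pred W) (F : W -> M) :
  a *:: (\sum_(y <- X | P y) F y) = \sum_(y <- X | P y) a *:: F y.
Proof. exact: scaler_sumr. Qed.

End Scalars.

Section Coordinates.
Variables (W : groupType) (S : set W) (M : lmodType (hecke S)).
Variables (I : set W) (c : W -> M).
Hypothesis basis_c : is_basis I c.

Lemma big_basis_widen (X Y : seq W) (f : W -> laurent) :
  uniq X -> uniq Y -> {subset X <= Y} -> (forall w, w \notin X -> f w = 0) ->
  \sum_(w <- X) f w *:: c w = \sum_(w <- Y) f w *:: c w.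
Proof.
move=> uX uY XY f0; rewrite [RHS](bigID (mem X)) /=.
rewrite [X in _ + X]big1 => [|w]; last first.
  by move=> /f0->; rewrite ascale0.
rewrite addr0 -[RHS]big_filter; apply: perm_big; apply: uniq_perm => //.
  exact: filter_uniq.
by move=> w; rewrite mem_filter /= andb_idr //; exact: XY.
Qed.

(** The function is required to vanish outside the finite list X, which makes
    it unique even though X is not. *)
Definition expansion (m : M) (f : W -> laurent) := exists X : seq W,
  [/\ uniq X, (forall w, w \in X -> I w), (forall w, w \notin X -> f w = 0) &
      m = \sum_(w <- X) f w *:: c w].

Lemma expansionD m n f g : expansion m f -> expansion n g ->
  expansion (m + n) (fun w => f w + g w).
Proof.
move=> [X [uX XI X0 ->]] [Y [uY YI Y0 ->]]; exists (undup (X ++ Y)).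
have sX : {subset X <= undup (X ++ Y)}.
  by move=> w wX; rewrite mem_undup mem_cat wX.
have sY : {subset Y <= undup (X ++ Y)}.
  by move=> w wY; rewrite mem_undup mem_cat wY orbT.
split; first exact: undup_uniq.
- by move=> w; rewrite mem_undup mem_cat => /orP[/XI|/YI].
- by move=> w; rewrite mem_undup mem_cat negb_or => /andP[/X0-> /Y0->];
  rewrite addr0.
rewrite (big_basis_widen uX (undup_uniq _) sX X0).
rewrite (big_basis_widen uY (undup_uniq _) sY Y0) -big_split /=.
by apply: eq_bigr => w _; rewrite ascaleDl.
Qed.

Lemma expansionZ a m f :
  expansion m f -> expansion (a *:: m) (fun w => a * f w).
Proof.
move=> [X [uX XI X0 ->]]; exists X; split=> // [w /X0->|].
  by rewrite mulr0.
by rewrite ascale_sumr; apply: eq_bigr => w _; rewrite ascaleA.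
Qed.

Lemma expansion_basis y : I y -> expansion (c y) (fun w => (w == y)%:R).
Proof.
move=> Iy; exists [:: y]; split=> // [w|w|].
- by rewrite inE => /eqP->.
- by rewrite inE => /negPf->.
- by rewrite big_seq1 eqxx ascale1.
Qed.

Lemma expansion_ex m : exists f, expansion m f.
Proof.
have [X [f [XI ->]]] := basis_c.2 m; elim: X XI => [|y X IHX] XI.
  by exists (fun=> 0), [::]; split=> //; rewrite !big_nil.
have [|g Xg] := IHX; first by move=> w wX; apply: XI; rewrite inE wX orbT.
rewrite big_cons; eexists; apply: expansionD Xg.
by apply: expansionZ; apply: expansion_basis; apply: XI; rewrite inE eqxx.
Qed.

Lemma expansion0 f : expansion 0 f -> f =1 fun=> 0.
Proof.
move=> [X [uX XI X0 /esym e]] w.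
have [wX|/X0//] := boolP (w \in X); exact: basis_c.1 e _ wX.
Qed.

Lemma expansion_uniq m f g : expansion m f -> expansion m g -> f =1 g.
Proof.
move=> mf /(expansionZ (-1)) /(expansionD mf).
rewrite ascaleNl ascale1 subrr => /expansion0 e w.
by have /eqP := e w; rewrite mulN1r subr_eq0 => /eqP.
Qed.


Definition coord m : W -> laurent := sval (cid (expansion_ex m)).

Lemma coordP m : expansion m (coord m).
Proof. by rewrite /coord; case: cid. Qed.

Lemma coord_expansion m f : expansion m f -> coord m =1 f.
Proof. exact/expansion_uniq/coordP. Qed.

Lemma coordD m n w : coord (m + n) w = coord m w + coord n w.
Proof. exact: (coord_expansion (expansionD (coordP m) (coordP n))). Qed.

Lemma coordZ a m w : coord (a *:: m) w = a * coord m w.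
Proof. exact: (coord_expansion (expansionZ a (coordP m))). Qed.

Lemma coord_basis y w : I y -> coord (c y) w = (w == y)%:R.
Proof. by move=> Iy; exact: (coord_expansion (expansion_basis Iy)). Qed.

Lemma coord_sum (X : seq W) (P : pred W) (F : W -> M) w :
  coord (\sum_(y <- X | P y) F y) w = \sum_(y <- X | P y) coord (F y) w.
Proof.
apply: (big_morph (coord^~ w)) => [m n|]; first exact: coordD.
by rewrite -(ascale0 0) coordZ mul0r.
Qed.

Lemma coord_eq0 m : coord m =1 (fun=> 0) -> m = 0.
Proof.
have [X [_ _ _ e]] := coordP m => m0; rewrite e big1 // => w _.
by rewrite m0 ascale0.
Qed.

(** Semilinearity and the invariance of the basis make the bar involution act
    on each coordinate separately. *)
Lemma coord_bar (bar : M -> M) m w :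
    {morph bar : x y / x + y} ->
    (forall a x, bar (a *:: x) = lbar a *:: bar x) ->
    (forall y, I y -> bar (c y) = c y) ->
  coord (bar m) w = lbar (coord m w).
Proof.
move=> barD barZ barc; apply: (@coord_expansion _ (fun y => lbar (coord m y))).
have [X [uX XI X0 e]] := coordP m; exists X; split=> // [y /X0->|].
  by rewrite rmorph0.
have bar0 : bar 0 = 0 by rewrite -(ascale0 0) barZ rmorph0 !ascale0.
rewrite {1}e (big_morph bar barD bar0) big_seq [RHS]big_seq.
by apply: eq_bigr => y /XI Iy; rewrite barZ barc.
Qed.

End Coordinates.

(** * The lattice spanned over Z[q] by the basis *)

Section Lattice.
Variables (W : groupType) (S : set W) (M : lmodType (hecke S)).
Variables (I : set W) (c : W -> M).
Hypothesis basis_c : is_basis I c.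

(** The lattice q^k L, where L is the Z[q]-span of the basis; congruence
    modulo q L is membership of the difference in [lattice 1]. *)
Definition lattice (k : nat) (m : M) : Prop := forall w,
  exists p : {poly int}, coord basis_c m w = lq ^+ k * of_poly p.

Lemma latticeD k m n : lattice k m -> lattice k n -> lattice k (m + n).
Proof.
move=> Lm Ln w; have [p mw] := Lm w; have [r nw] := Ln w.
by exists (p + r); rewrite coordD mw nw rmorphD mulrDr.
Qed.

Lemma latticeZ k p m : lattice k m -> lattice k (of_poly p *:: m).
Proof.
move=> Lm w; have [r mw] := Lm w.
by exists (p * r); rewrite coordZ mw rmorphM mulrCA.
Qed.

Lemma latticeN k m : lattice k m -> lattice k (- m).
Proof.
by move=> /(latticeZ (-1)); rewrite rmorphN rmorph1 ascaleNl ascale1.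
Qed.

Lemma latticeB k m n : lattice k m -> lattice k n -> lattice k (m - n).
Proof. by move=> Lm Ln; apply: latticeD => //; exact: latticeN. Qed.

Lemma lattice0 k : lattice k 0.
Proof.
by move=> w; exists 0; rewrite -(ascale0 0) coordZ mul0r rmorph0 mulr0.
Qed.

Lemma lattice_sum k (X : seq W) (P : pred W) (F : W -> M) :
  (forall y, y \in X -> P y -> lattice k (F y)) ->
  lattice k (\sum_(y <- X | P y) F y).
Proof.
move=> LF; rewrite big_seq_cond; apply: big_ind => [||y /andP[]].
- exact: lattice0.
- exact: latticeD.
- exact: LF.
Qed.

Lemma latticeS k m : lattice k m -> lattice k.+1 (lq *:: m).
Proof.
move=> Lm w; have [r mw] := Lm w.
by exists r; rewrite coordZ mw mulrA exprS.
Qed.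

Lemma lattice_weaken k m : lattice k.+1 m -> lattice k m.
Proof.
move=> Lm w; have [r mw] := Lm w.
by exists ('X * r); rewrite mw rmorphM -/lq mulrA exprSr.
Qed.

Lemma lattice_basis y : I y -> lattice 0 (c y).
Proof.
move=> Iy w; exists ((w == y)%:R); rewrite coord_basis // mul1r.
by case: eqP; rewrite ?rmorph1 ?rmorph0.
Qed.

Variable bar : M -> M.
Hypothesis barD : {morph bar : x y / x + y}.
Hypothesis barZ : forall a x, bar (a *:: x) = lbar a *:: bar x.
Hypothesis barc : forall y, I y -> bar (c y) = c y.

(** Rigidity: a coordinate q p(q) fixed by q |-> q^-1 is a constant without
    constant term. *)
Lemma bar_fixed_lattice1_eq0 m : bar m = m -> lattice 1 m -> m = 0.
Proof.
move=> fix_m Lm; apply: (coord_eq0 (basis_c := basis_c)) => w.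
have [p] := Lm w; rewrite expr1 -rmorphM /= => mw.
have := coord_bar basis_c m w barD barZ barc; rewrite fix_m mw.
move=> /esym/lbar_of_poly_fixed[k e]; rewrite e.
have -> : k = 0.
  have := congr1 (fun r : {poly int} => r`_0) e.
  by rewrite mulrC coefMX coefC.
by rewrite rmorph0.
Qed.

End Lattice.

(** * The action of T_s on a W-graph basis *)

Section WGraph.
Variables (W : groupType) (S : set W) (I : set W) (J : set S).
Variables (M : lmodType (hecke S)) (b : W -> M) (bar : M -> M).
Variables (c : W -> M) (Q : W -> W -> {poly int}).
Hypothesis coxS : coxeter_system S.
Hypothesis idealI : wgraph_ideal I J b bar.
Hypothesis basis_cQ : wgraph_basis I b bar c Q.

Let basis_c : is_basis I c := wb_basis basis_cQ.
Let barD := wg_barD idealI.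
Let barZ := wg_barZ idealI.
Let barc := wb_bar basis_cQ.

Local Notation lattice := (lattice basis_c).

(** Lists replace the finitely supported sums, so that the usual lemmas on
    iterated sums apply; this is legitimate because the sets are finite. *)
Definition below (w : W) : seq W :=
  fset_set [set y | I y /\ bruhat_lt S y w].

Lemma below_set_finite w : finite_set [set y | I y /\ bruhat_lt S y w].
Proof.
by apply: sub_finite_set (bruhat_interval_finite coxS w) => y [_ []].
Qed.

Lemma mem_below y w : y \in below w <-> I y /\ bruhat_lt S y w.
Proof.
rewrite /below in_fset_set; last exact: below_set_finite.
by rewrite in_setE.
Qed.

Lemma below_uniq w : uniq (below w). Proof. exact: fset_uniq. Qed.

Lemma fsbig_below w (F : W -> M) :
  \sum_(y \in [set y | I y /\ bruhat_lt S y w]) F y = \sum_(y <- below w) F y.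
Proof. by rewrite fsbig_finite //; exact: below_set_finite. Qed.

Definition is_descent (s : S) (y : W) : bool := `[< descents J y s >].

Lemma fsbig_Rset s w (F : W -> M) :
  \sum_(y \in Rset I J s w) F y = \sum_(y <- below w | is_descent s y) F y.
Proof.
have -> : Rset I J s w =
    ([set y | I y /\ bruhat_lt S y w] `&` [set y | is_descent s y])%classic.
  by apply/seteqP; split=> y /=; rewrite /is_descent; [move=> [Iy yw /asboolP]|
     move=> [[Iy yw] /asboolP]].
rewrite fsbig_mkcondr fsbig_below [RHS]big_mkcond /=.
by apply: eq_bigr => y _; rewrite mem_setE.
Qed.

Lemma b_expand w : I w ->
  b w = c w + lq *:: \sum_(y <- below w) of_poly (Q y w) *:: c y.
Proof. by move=> Iw; rewrite (wb_b basis_cQ Iw) fsbig_below. Qed.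

Lemma b_congr_c w : I w -> lattice 1 (b w - c w).
Proof.
move=> Iw; rewrite b_expand // addrC addKr; apply/latticeS/lattice_sum.
by move=> y /mem_below[Iy _] _; apply/latticeZ/lattice_basis.
Qed.

Lemma b_lattice w : I w -> lattice 0 (b w).
Proof.
move=> Iw; rewrite -[b w](subrK (c w)); apply: latticeD (lattice_basis _ Iw).
exact/lattice_weaken/b_congr_c.
Qed.

Lemma SD_closed (s : S) w : I w -> SD w s -> I (val s * w)%g.
Proof.
by move=> Iw sw; apply: (wg_ideal idealI Iw); exact: weak_le_descent.
Qed.

Lemma SD_SA (s : S) w : I w -> SD w s -> SA I (val s * w)%g s.
Proof. by move=> Iw sw; split; rewrite genK. Qed.

Lemma SA_descent (s : S) w : SA I w s -> is_descent s (val s * w)%g.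
Proof. by move=> [sw _]; apply/asboolP; left; rewrite /SD /= genK. Qed.

(** The four types of generators exhaust S, since sw and w are always
    comparable. *)
Lemma ascent_cases (s : S) w : I w -> ~~ is_descent s w ->
  SA I w s \/ WA I J w s.
Proof.
move=> Iw /asboolPn nD; have [lt|lt] := bruhat_lt_genP coxS s w; last first.
  by case: nD; left.
have [Isw|nIsw] := pselect (I (val s * w)%g); first by left.
have [Jsw|nJsw] := pselect (minrep J (val s * w)%g); first by right.
by case: nD; right.
Qed.

(** The two factors of the quadratic relation (T_s - q)(T_s + q^-1) = 0.
    They are used in place of T_s because both are bar-invariant. *)
Definition hTq (s : S) : hecke S := hT s - lq%:A.
Definition hTqV (s : S) : hecke S := hT s + lqV%:A.

Lemma hTqE s (m : M) : hTq s *: m = hT s *: m - lq *:: m.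
Proof. exact: scalerBl. Qed.

Lemma hTqVE s (m : M) : hTqV s *: m = hT s *: m + lqV *:: m.
Proof. exact: scalerDl. Qed.

Lemma hTqV_hTq s (m : M) : hTqV s *: m = hTq s *: m + (lq + lqV) *:: m.
Proof. by rewrite hTqE hTqVE ascaleDl addrA subrK. Qed.

Lemma hbar_hTq s : hbar (hTq s) = hTq s.
Proof.
rewrite /hTq hbarD hbar_T -[- _ in LHS]scaleNr hbar_scalar rmorphN /=.
rewrite lbar_q /hTV.
by rewrite scaleNr scalerBl opprB addrA addrAC addrK.
Qed.

Lemma hbar_hTqV s : hbar (hTqV s) = hTqV s.
Proof.
rewrite /hTqV hbarD hbar_T hbar_scalar lbar_qV /hTV scalerBl opprB.
by rewrite addrA subrK.
Qed.

Lemma hTqV_mul_hTq s : hTqV s * hTq s = 0.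
Proof.
rewrite /hTqV /hTq mulrBr mulr_algr mulrDl hT_quad mulr_algl.
rewrite scalerDr scalerA lqK.
by rewrite scalerBl -[X in X - _]addrA subrK scale1r [1 + _]addrC subrr.
Qed.

Lemma bar_hTq s m : bar m = m -> bar (hTq s *: m) = hTq s *: m.
Proof. by move=> mE; rewrite (wg_bar_hecke idealI) hbar_hTq mE. Qed.

Lemma bar_hTqV s m : bar m = m -> bar (hTqV s *: m) = hTqV s *: m.
Proof. by move=> mE; rewrite (wg_bar_hecke idealI) hbar_hTqV mE. Qed.

Lemma hTq_b_SA (s : S) y : I y -> SA I y s ->
  lattice 1 (hTq s *: b y - c (val s * y)%g).
Proof.
move=> Iy sy; rewrite hTqE (wg_SA idealI Iy sy) addrAC.
have [_ Isy] := sy.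
by apply: latticeB; [exact: b_congr_c|exact/latticeS/b_lattice].
Qed.

Lemma hTq_b_WA (s : S) y : I y -> WA I J y s -> lattice 1 (hTq s *: b y).
Proof.
move=> Iy sy; rewrite hTqE; have [r [rX ->]] := wg_WA idealI Iy sy.
rewrite addrAC subrr sub0r fsbig_below; apply/latticeN/lattice_sum.
move=> z /mem_below[Iz _] _; have [r' ->] := rX z.
by rewrite rmorphM -ascaleA; exact/latticeS/latticeZ/b_lattice.
Qed.

Lemma hTq_b_descent (s : S) y : I y -> is_descent s y ->
  lattice 1 (lq *:: (hTq s *: b y) + c y).
Proof.
move=> Iy /asboolP[sy|sy]; rewrite hTqE.
  have Isy := SD_closed Iy sy.
  have -> : lq *:: (hT s *: b y - lq *:: b y) + c y =
      lq *:: b (val s * y)%g - (b y - c y).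
    rewrite (wg_SD idealI Iy sy) ascaleBl addrA addrAC addrK.
    by rewrite ascaleDr ascaleNr ascaleA lqK ascale1 opprB addrA addrAC.
  by apply: latticeB; [exact/latticeS/b_lattice|exact: b_congr_c].
have -> : lq *:: (hT s *: b y - lq *:: b y) + c y =
    - (b y - c y) - lq *:: (of_poly 'X *:: b y).
  rewrite (wg_WD idealI Iy sy) ascaleDr ascaleNl !ascaleNr ascaleA lqK ascale1.
  by rewrite opprB addrAC [- _ + c y]addrC.
apply: latticeB; first exact/latticeN/b_congr_c.
exact/latticeS/latticeZ/b_lattice.
Qed.

(** The weak ascents disappear modulo q because their coefficients r^s_(y,w)
    lie in q Z[q]; the strong ones give (T_s - q) b_y in L; only the
    eigenvalue - q^-1 on descents leaves a trace after multiplication by q. *)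
Lemma hTq_b (s : S) y : I y ->
  lattice 1 (lq *:: (hTq s *: b y) + c y *+ is_descent s y).
Proof.
move=> Iy; have [D|nD] := boolP (is_descent s y); first exact: hTq_b_descent.
rewrite mulr0n addr0; apply: latticeS.
have [sy|sy] := ascent_cases Iy nD; last exact/lattice_weaken/hTq_b_WA.
have [_ Isy] := sy; rewrite -[hTq s *: b y](subrK (c (val s * y)%g)).
apply: latticeD (lattice_basis _ Isy); exact/lattice_weaken/hTq_b_SA.
Qed.

Lemma hTq_expand (s : S) w : I w ->
  hTq s *: c w = hTq s *: b w -
    \sum_(y <- below w) of_poly (Q y w) *:: (lq *:: (hTq s *: c y)).
Proof.
move=> Iw; rewrite (b_expand Iw) scalerDr hecke_ascale scaler_sumr ascale_sumr.
rewrite -[LHS]addr0 -addrA; congr (_ + _); apply/esym/eqP; rewrite subr_eq0.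
apply/eqP; apply: eq_bigr => y _.
by rewrite hecke_ascale !ascaleA mulrC.
Qed.

(** In the expansion of c_w, each term with y < w carries a factor q besides
    q (T_s - q) c_y, which lies in L by induction; so c_w behaves like b_w
    modulo q L. *)
Lemma hTq_c (s : S) w : I w ->
  lattice 1 (lq *:: (hTq s *: c w) + c w *+ is_descent s w).
Proof.
have [n] := ubnP (length S w); elim: n w => // n IHn w wn Iw.
rewrite (hTq_expand s Iw) ascaleDr ascaleNr addrAC.
apply: latticeB; first exact: hTq_b.
apply/latticeS/lattice_sum => y /mem_below[Iy yw] _; apply: latticeZ.
have yn : (length S y < n)%N by apply: leq_trans (bruhat_lt_length coxS yw) _.
rewrite -[lq *:: _](addrK (c y *+ is_descent s y)); apply: latticeB.
  exact/lattice_weaken/IHn.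
by case: is_descent; [exact: lattice_basis|exact: lattice0].
Qed.

Lemma bar_zero : bar 0 = 0.
Proof. by rewrite -(ascale0 0) barZ rmorph0 !ascale0. Qed.

Lemma bar_opp m : bar (- m) = - bar m.
Proof. by apply/eqP; rewrite -addr_eq0 -barD addNr bar_zero. Qed.

Definition mu_sum (s : S) (w : W) : M :=
  \sum_(y <- below w | is_descent s y) c y *~ mu Q y w.

Lemma bar_mu_sum s w : bar (mu_sum s w) = mu_sum s w.
Proof.
rewrite /mu_sum (big_morph bar barD bar_zero) big_seq_cond [RHS]big_seq_cond.
apply: eq_bigr => y /andP[/mem_below[Iy _] _].
by rewrite -ascale_int barZ rmorph_int barc.
Qed.

(** The common core of the two ascent formulas.  The factor q in front of the
    q_(y,w) cancels the denominator of (T_s - q) c_y, so that exactly the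
    constant terms mu_(y,w) at descents remain modulo q L.  Both sides are
    bar-invariant, and rigidity turns the congruence into an equality. *)
Lemma hTq_c_mod (s : S) w z : I w -> bar z = z ->
  lattice 1 (hTq s *: b w - z) -> hTq s *: c w = z + mu_sum s w.
Proof.
move=> Iw zE Lz; apply/eqP; rewrite -subr_eq0; apply/eqP.
apply: (bar_fixed_lattice1_eq0 (basis_c := basis_c) barD barZ barc).
  by rewrite barD bar_opp barD zE bar_mu_sum bar_hTq ?barc.
rewrite (hTq_expand s Iw) opprD addrACA -opprD; apply: latticeB => //.
rewrite /mu_sum [X in _ + X]big_mkcond -big_split /=; apply: lattice_sum.
move=> y /mem_below[Iy _] _.
have -> : (if is_descent s y then c y *~ mu Q y w else 0) =
    (mu Q y w)%:~R *:: (c y *+ is_descent s y).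
  by rewrite ascale_int; case: is_descent; rewrite ?mul0rz.
have := hTq_c s Iy; set d := _ *+ _ => Ld.
have -> : of_poly (Q y w) *:: (lq *:: (hTq s *: c y)) + (mu Q y w)%:~R *:: d =
    of_poly (Q y w) *:: (lq *:: (hTq s *: c y) + d) -
    of_poly (Q y w - (mu Q y w)%:P) *:: d.
  rewrite ascaleDr rmorphB /= ascaleBl of_poly_int opprB.
  by rewrite addrACA subrr addr0.
apply: latticeB; first exact: latticeZ.
have [r ->] : exists r, Q y w - (mu Q y w)%:P = 'X * r.
  exists (\poly_(i < size (Q y w)) (Q y w)`_i.+1); apply/polyP => i.
  rewrite coefXM coefB coefC coef_poly; case: i => [|i] /=.
    by rewrite subrr.
  by rewrite subr0; case: ltnP => // /leqW/(nth_default 0).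
rewrite rmorphM -ascaleA; apply/latticeS/latticeZ.
by rewrite /d; case: is_descent; [exact: lattice_basis|exact: lattice0].
Qed.

Lemma hTq_c_SA (s : S) w : I w -> SA I w s ->
  hTq s *: c w = c (val s * w)%g + mu_sum s w.
Proof.
move=> Iw sw; apply: hTq_c_mod (hTq_b_SA Iw sw) => //.
by case: sw => _ Isw; rewrite barc.
Qed.

Lemma hTq_c_WA (s : S) w : I w -> WA I J w s -> hTq s *: c w = mu_sum s w.
Proof.
move=> Iw sw; rewrite -[RHS]add0r; apply: hTq_c_mod => //.
  exact: bar_zero.
by rewrite subr0; exact: hTq_b_WA.
Qed.

Lemma coord_descent_basis (s : S) y z : I y ->
  is_descent s y -> ~~ is_descent s z -> coord basis_c (c y) z = 0.
Proof.
move=> Iy Dy nDz; rewrite coord_basis //; case: eqP => // zy.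
by rewrite zy Dy in nDz.
Qed.

(** In the ascent formulas, (T_s - q) c_y is a combination of c_(sy) and
    of c_x with s a descent of x, and s is a descent of sy as well. *)
Lemma coord_hTq_ascent (s : S) y z : I y ->
  ~~ is_descent s y -> ~~ is_descent s z ->
  coord basis_c (hTq s *: c y) z = 0.
Proof.
move=> Iy nDy nDz.
have coord_mu : coord basis_c (mu_sum s y) z = 0.
  rewrite coord_sum big_seq_cond big1 // => x /andP[/mem_below[Ix _] Dx].
  by rewrite -ascale_int coordZ (coord_descent_basis Ix Dx nDz) mulr0.
have [sy|sy] := ascent_cases Iy nDy; last by rewrite hTq_c_WA.
have [_ Isy] := sy; rewrite hTq_c_SA // coordD coord_mu addr0.
exact: (coord_descent_basis Isy (SA_descent sy) nDz).
Qed.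

Lemma coord_hTqV_ascent (s : S) y z : I y ->
  ~~ is_descent s y -> ~~ is_descent s z ->
  coord basis_c (hTqV s *: c y) z = (lq + lqV) * (z == y)%:R.
Proof.
move=> Iy nDy nDz.
by rewrite hTqV_hTq coordD coord_hTq_ascent // add0r coordZ coord_basis.
Qed.

(** The product (T_s + q^-1)(T_s - q) kills c_(sw), and (T_s - q) c_(sw) is c_w
    plus elements c_y with s a descent of y, which are killed by hypothesis. *)
Lemma hTqV_SD (s : S) w : I w -> SD w s ->
  (forall y, I y -> (length S y < length S w)%N -> is_descent s y ->
     hTqV s *: c y = 0) ->
  hTqV s *: c w = 0.
Proof.
move=> Iw sw IHw; have Isw := SD_closed Iw sw.
have := congr1 (fun m => hTqV s *: m) (hTq_c_SA Isw (SD_SA Iw sw)).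
rewrite /= (genK coxS) scalerA hTqV_mul_hTq scale0r scalerDr => /esym/eqP.
rewrite addr_eq0 => /eqP->; apply/eqP.
rewrite oppr_eq0 scaler_sumr big_seq_cond.
rewrite big1 // => y /andP[/mem_below[Iy ysw] Dy].
rewrite -ascale_int hecke_ascale IHw // ?ascale_int ?mul0rz //.
exact: ltn_trans (bruhat_lt_length coxS ysw) (bruhat_lt_length coxS sw).
Qed.

(** Since T_s + q^-1 kills b_w, the element (T_s + q^-1) c_w is a combination of
    the (T_s + q^-1) c_y with y < w; bar-invariance shows that no y without
    descent s contributes. *)
Lemma hTqV_WD (s : S) w : I w -> WD J w s ->
  (forall y, I y -> (length S y < length S w)%N -> is_descent s y ->
     hTqV s *: c y = 0) ->
  hTqV s *: c w = 0.
Proof.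
move=> Iw sw IHw.
have IHb y : y \in below w -> is_descent s y -> hTqV s *: c y = 0.
  by move=> /mem_below[Iy yw]; apply: IHw => //; exact: bruhat_lt_length yw.
have cwE : hTqV s *: c w =
    - (lq *:: \sum_(y <- below w) of_poly (Q y w) *:: (hTqV s *: c y)).
  have := congr1 (fun m => hTqV s *: m) (b_expand Iw).
  rewrite /= hTqVE (wg_WD idealI Iw sw) ascaleNl addNr scalerDr => /esym/eqP.
  rewrite addr_eq0 => /eqP->; rewrite hecke_ascale scaler_sumr.
  by congr (- (_ *:: _)); apply: eq_bigr => y _; rewrite hecke_ascale.
have bar_cw : bar (hTqV s *: c w) = hTqV s *: c w by rewrite bar_hTqV ?barc.
have Q0 z : z \in below w -> ~~ is_descent s z -> Q z w = 0.
  move=> zw nDz.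
  (* Only the term of z itself contributes to the coordinate at z. *)
  have cz : coord basis_c (hTqV s *: c w) z = - of_poly (('X ^+ 2 + 1) * Q z w).
    rewrite cwE -ascaleNl coordZ coord_sum (bigD1_seq z) ?below_uniq //=.
    rewrite big_seq_cond big1 ?addr0 => [|y /andP[yw yz]].
      have [Iz _] := (mem_below z w).1 zw.
      rewrite coordZ coord_hTqV_ascent // eqxx mulr1 mulNr mulrCA mulrDr lqK.
      by rewrite rmorphM rmorphD rmorph1 rmorphXn expr2 mulrC.
    have [Iy _] := (mem_below y w).1 yw.
    have [Dy|nDy] := boolP (is_descent s y).
      by rewrite IHb // -(ascale0 0) ascaleA mulr0 coordZ mul0r.
    by rewrite coordZ coord_hTqV_ascent // eq_sym (negPf yz) !mulr0.
  have := coord_bar basis_c (hTqV s *: c w) z barD barZ barc.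
  rewrite bar_cw cz rmorphN => /oppr_inj/esym/lbar_of_poly_fixed[k e].
  (* The factor q^2 + 1 makes a nonzero polynomial non-constant. *)
  apply/eqP/negPn/negP => Qn0.
  have := congr1 (fun p : {poly int} => size p) e.
  have X2 : size ('X ^+ 2 + 1 : {poly int}) = 3%N.
    by rewrite size_polyDl ?size_polyXn ?size_poly1.
  rewrite size_mul // -?size_poly_eq0 ?X2 //= => sE.
  have := size_polyC_leq1 k; rewrite -sE -size_poly_gt0 in Qn0 *.
  by case: (size _) Qn0.
rewrite cwE big_seq big1 ?ascaleNr => [|y yw].
  by rewrite -(ascale0 0) ascaleA mulr0 ascale0 oppr0.
have [Dy|nDy] := boolP (is_descent s y).
  by rewrite IHb // -(ascale0 0) ascaleA mulr0 ascale0.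
by rewrite Q0 // rmorph0 ascale0.
Qed.

Lemma hTqV_c_descent (s : S) w : I w -> is_descent s w -> hTqV s *: c w = 0.
Proof.
have [n] := ubnP (length S w); elim: n w => // n IHn w wn Iw /asboolP Dw.
have IHw y : I y -> (length S y < length S w)%N -> is_descent s y ->
    hTqV s *: c y = 0.
  by move=> Iy yw; apply: IHn => //; exact: leq_trans yw _.
by case: Dw => sw; [exact: hTqV_SD|exact: hTqV_WD].
Qed.

End WGraph.

Theorem theorem7p3 (W : groupType) (S : set W) (I : set W) (J : set S)
    (M : lmodType (hecke S)) (b : W -> M) (bar : M -> M)
    (c : W -> M) (Q : W -> W -> {poly int})
    (hS : coxeter_system S)
    (hI : wgraph_ideal I J b bar)
    (hc : wgraph_basis I b bar c Q)
    (s : S) (w : W) (hw : I w) :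
  [/\ descents J w s ->
        hT s *: c w = - lqV *:: c w,
      WA I J w s ->
        hT s *: c w = lq *:: c w
          + \sum_(y \in Rset I J s w) c y *~ mu Q y w
    & SA I w s ->
        hT s *: c w = lq *:: c w + c (val s * w)%g
          + \sum_(y \in Rset I J s w) c y *~ mu Q y w].
Proof.
rewrite (fsbig_Rset I J hS); split=> sw.
- have := hTqV_c_descent hS hI hc hw (asboolT sw).
  by rewrite hTqVE => /eqP; rewrite addr_eq0 ascaleNl => /eqP.
- by rewrite addrC -[hT s *: _](subrK (lq *:: c w)) -hTqE (hTq_c_WA hS hI hc).
- rewrite -addrA addrC -[hT s *: _](subrK (lq *:: c w)) -hTqE.
  by rewrite (hTq_c_SA hS hI hc).
Qed.
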